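(* Let $X$, $Y$ and $Z$ be metric spaces, let $s_1, s_2, r \ge 0$, let $f, g : X \to Y$ be $s_1$-Lipschitz maps and let $h : Y \to Z$ be an $s_2$-Lipschitz map. Then $D^{(s_1 s_2)}_{s_2 r}(h \circ f, h \circ g) \le D^{(s_1)}_r(f, g)$.
   Context: For a non-negative integer $m$, $[m] = \{0, 1, \dots, m\}$ carries the metric $d(a,b) = |a-b|$. For $s \ge 0$, a map $\varphi$ between metric spaces is $s$-Lipschitz if $d(\varphi(x), \varphi(x')) \le s\, d(x,x')$ for all $x,x'$. For $s, r \ge 0$ and maps $f, g : X \to Y$ between metric spaces, an $(s,r)$-homotopy between $f$ and $g$ is a map $F : X \times [m] \to Y$, for some non-negative integer $m$, such that (1) $F(x,-) : [m] \to Y$ is $r$-Lipschitz for every $x \in X$; (2) $F(-,i) : X \to Y$ is $s$-Lipschitz for every $i \in [m]$; (3) $F(x,0) = f(x)$ and $F(x,m) = g(x)$ for all $x \in X$. One writes $f \simeq_{(s,r)} g$ if such an $F$ exists. For two $s$-Lipschitz maps $f,g : X \to Y$, the discrete homotopic distance $D^{(s)}_r(f,g)$ is the smallest integer $k \ge 0$ for which there is an open cover $U_0, \dots, U_k$ of $X$ with $f|_{U_i} \simeq_{(s,r)} g|_{U_i}$ (as maps $U_i \to Y$) for all $i = 0, \dots, k$; it is $\infty$ if no such cover exists. *)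

(* Defs.v *)
From HB Require Import structures.
From mathcomp Require Import all_boot all_order all_algebra.
From mathcomp Require Import all_classical all_reals all_analysis.

Set Implicit Arguments.
Unset Strict Implicit.
Unset Printing Implicit Defensive.

Import Order.TTheory GRing.Theory Num.Theory.

Local Open Scope classical_set_scope.
Local Open Scope ring_scope.

Section SubspaceMetric.
Context (R : realType) (X : metricType R) (A : set X).

Let sdist (x y : A) : R := mdist (\val x) (\val y).

Let sdist_ge0 x y : 0 <= sdist x y.
Proof. exact: mdist_ge0. Qed.

Let sdist_positivity x y : sdist x y = 0 -> x = y.
Proof. by move=> /mdist_positivity /val_inj. Qed.

Let ballEsdist (x : A) (d : R) : ball x d = [set y | sdist x y < d].
Proof.
rewrite predeqE => y.
by change (ball (\val x) d (\val y) <-> sdist x y < d); rewrite ballEmdist.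
Qed.

(* Completes the library's pseudometric structure on [set_type A] (induced by
   the inclusion) into a metric one. *)
HB.instance Definition _ := PseudoMetric_isMetric.Build R (set_type A)
  sdist_ge0 sdist_positivity ballEsdist.

End SubspaceMetric.

(* {0, ..., m}; the alias depends on R so as to carry an R-valued metric. *)
Definition int_segment (R : realType) (m : nat) : Type := 'I_m.+1.

Section SegmentMetric.
Context (R : realType) (m : nat).

HB.instance Definition _ := Choice.copy (int_segment R m) 'I_m.+1.

Let segdist (i j : int_segment R m) : R :=
  `|(nat_of_ord i)%:R - (nat_of_ord j)%:R|.

Let segdistxx i : segdist i i = 0.
Proof. by rewrite /segdist subrr normr0. Qed.

Let segdist_positivity i j : segdist i j = 0 -> i = j.
Proof.
move=> /eqP; rewrite normr_eq0 subr_eq0 eqr_nat => /eqP ij.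
exact: (@ord_inj m.+1).
Qed.

Let segdist_sym i j : segdist i j = segdist j i.
Proof. exact: distrC. Qed.

Let segdist_triangle j i k : segdist i k <= segdist i j + segdist j k.
Proof. exact: ler_distD. Qed.

HB.instance Definition _ := isMetric.Build R (int_segment R m)
  segdistxx segdist_positivity segdist_sym segdist_triangle.

End SegmentMetric.

(* The library's [k.-lipschitz] is restricted to normed modules. *)
Definition lipschitz_map (R : realType) (X Y : metricType R) (s : R)
    (phi : X -> Y) : Prop :=
  forall x x' : X, mdist (phi x) (phi x') <= s * mdist x x'.

Definition is_homotopy (R : realType) (X Y : metricType R) (s r : R)
    (f g : X -> Y) (m : nat) (F : X * int_segment R m -> Y) : Prop :=
  [/\ forall x : X, lipschitz_map r (fun i : int_segment R m => F (x, i)),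
      forall i : int_segment R m, lipschitz_map s (fun x : X => F (x, i)),
      forall x : X, F (x, ord0) = f x
    & forall x : X, F (x, ord_max) = g x].

Definition homotopic (R : realType) (X Y : metricType R) (s r : R)
    (f g : X -> Y) : Prop :=
  exists (m : nat) (F : X * int_segment R m -> Y), is_homotopy s r f g F.

(* There is an open cover U_0, ..., U_k (k + 1 sets, possibly empty). *)
Definition homotopic_cover (R : realType) (X Y : metricType R) (s r : R)
    (f g : X -> Y) (k : nat) : Prop :=
  exists U : 'I_k.+1 -> set X,
    [/\ forall i, open (U i),
        \bigcup_i U i = setT
      & forall i, homotopic s r (fun x : U i => f (\val x))
                                (fun x : U i => g (\val x))].

(* Values lie in the integers extended with infinities; +oo encodes "no cover".
   [`[< P >]] turns the proposition P into the boolean required by [ex_minn]. *)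
Definition homotopic_distance (R : realType) (X Y : metricType R) (s r : R)
    (f g : X -> Y) : \bar int :=
  if pselect (exists k : nat, `[< homotopic_cover s r f g k >]) is left ex_k
  then (Posz (ex_minn ex_k))%:E
  else +oo%E.

(* Main.v *)
Require Import Defs.
From mathcomp Require Import all_boot all_order all_algebra.
From mathcomp Require Import all_classical all_reals all_analysis.

Set Implicit Arguments.
Unset Strict Implicit.
Unset Printing Implicit Defensive.

Import Order.TTheory GRing.Theory Num.Theory.

Local Open Scope ring_scope.

(** Post-composing a homotopy [F] with [h] multiplies both of its Lipschitz
    constants by that of [h] and carries its end maps [f], [g] to [h \o f],
    [h \o g] ([homotopic_comp]). An open cover witnessing a value of the distance
    for [f] and [g] therefore witnesses it, unchanged, for [h \o f] and [h \o g]
    ([homotopic_cover_comp]), and the distance, being the least witnessed value,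
    can only decrease ([homotopic_distance_le]). *)

Lemma lipschitz_map_comp (R : realType) (X Y Z : metricType R) (s t : R)
    (phi : X -> Y) (h : Y -> Z) :
  0 <= t -> lipschitz_map s phi -> lipschitz_map t h ->
  lipschitz_map (t * s) (h \o phi).
Proof.
move=> t0 phis ht x x' /=.
by rewrite (le_trans (ht _ _))// -mulrA ler_wpM2l.
Qed.

Lemma homotopic_comp (R : realType) (X Y Z : metricType R) (s r t : R)
    (f g : X -> Y) (h : Y -> Z) :
  0 <= t -> lipschitz_map t h -> homotopic s r f g ->
  homotopic (t * s) (t * r) (h \o f) (h \o g).
Proof.
move=> t0 ht [m [F [Fr Fs F0 Fm]]]; exists m, (h \o F); split.
- by move=> x; exact: (lipschitz_map_comp t0 (Fr x) ht).
- by move=> i; exact: (lipschitz_map_comp t0 (Fs i) ht).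
- by move=> x /=; rewrite F0.
- by move=> x /=; rewrite Fm.
Qed.

Lemma homotopic_cover_comp (R : realType) (X Y Z : metricType R) (s r t : R)
    (f g : X -> Y) (h : Y -> Z) (k : nat) :
  0 <= t -> lipschitz_map t h -> homotopic_cover s r f g k ->
  homotopic_cover (t * s) (t * r) (h \o f) (h \o g) k.
Proof.
move=> t0 ht [U [Uo Ucov Uhom]]; exists U; split=> // i.
exact: (homotopic_comp t0 ht (Uhom i)).
Qed.

(** Both distances are minima of sets of witnessed values, so inclusion of these
    sets reverses the order; the value [+oo] is the minimum of the empty set. *)
Lemma homotopic_distance_le (R : realType) (X Y X' Y' : metricType R)
    (s r s' r' : R) (f g : X -> Y) (f' g' : X' -> Y') :
  (forall k, homotopic_cover s r f g k -> homotopic_cover s' r' f' g' k) ->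
  (homotopic_distance s' r' f' g' <= homotopic_distance s r f g)%E.
Proof.
move=> sub; rewrite /homotopic_distance.
case: (pselect (exists k, `[< homotopic_cover s r f g k >])) => [ex|_];
  last exact: leey.
case: pselect => [ex'|nex'].
  rewrite lee_fin lez_nat.
  case: (ex_minnP ex) => k /asboolP /sub Pk _.
  by case: (ex_minnP ex') => k' _; apply; apply/asboolP.
by case: nex'; case: ex => k /asboolP /sub Pk; exists k; apply/asboolP.
Qed.

Theorem proposition4p2 (R : realType) (X Y Z : metricType R) (s1 s2 r : R)
    (hs1 : 0 <= s1) (hs2 : 0 <= s2) (hr : 0 <= r)
    (f g : X -> Y) (hf : lipschitz_map s1 f) (hg : lipschitz_map s1 g)
    (h : Y -> Z) (hh : lipschitz_map s2 h) :
  (homotopic_distance (s1 * s2) (s2 * r) (h \o f) (h \o g)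
    <= homotopic_distance s1 r f g)%E.
Proof.
apply: homotopic_distance_le => k; rewrite (mulrC s1).
exact: homotopic_cover_comp.
Qed.
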